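(* Let $p,q$ be distinct primes with $q\not\equiv 1\pmod p$, and let $t$ denote a fixed element of order $q$ in $\mathbb{Z}_{p^2}^\times$. Up to isomorphism, the unique left brace of size $p^2q$ of cyclic type with $|\ker\lambda|=p^2$ is $(B,+,\circ)$, where $B=\mathbb{Z}_{p^2}\times\mathbb{Z}_q$ and $$\begin{pmatrix} n\\ m\end{pmatrix}+\begin{pmatrix} s\\ r\end{pmatrix}=\begin{pmatrix} n+s\\ m+r\end{pmatrix},\qquad \begin{pmatrix} n\\ m\end{pmatrix}\circ\begin{pmatrix} s\\ r\end{pmatrix}=\begin{pmatrix} n+t^m s\\ m+r\end{pmatrix}$$ for every $0\leq n,s\leq p^2-1$ and $0\leq m,r\leq q-1$ (first coordinates are taken modulo $p^2$, second coordinates modulo $q$). In particular, $(B,\circ)\cong\mathbb{Z}_{p^2}\rtimes_t\mathbb{Z}_q$ and $(B,+,\circ)$ is a bi-skew brace.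
   Context: A skew (left) brace is a triple $(B,+,\circ)$ where $(B,+)$ and $(B,\circ)$ are groups such that $a\circ(b+c)=a\circ b-a+a\circ c$ for all $a,b,c\in B$; it is a left brace if $(B,+)$ is abelian, it is of cyclic type if $(B,+)$ is cyclic, and it is a bi-skew brace if $(B,\circ,+)$ is also a skew brace. The map $\lambda:(B,\circ)\to\mathrm{Aut}(B,+)$, $\lambda_a(b)=-a+a\circ b$, is a group homomorphism, with kernel $\ker\lambda$. Isomorphisms are bijections preserving both operations. $\mathbb{Z}_{p^2}^\times$ is the group of units modulo $p^2$, and $\mathbb{Z}_{p^2}\rtimes_t\mathbb{Z}_q=\langle\sigma,\tau\mid\sigma^{p^2}=\tau^q=1,\ \tau\sigma\tau^{-1}=\sigma^t\rangle$. *)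

(* Defs.v *)
From HB Require Import structures.
From mathcomp Require Export all_boot all_order all_fingroup all_algebra cyclic.

Set Implicit Arguments.
Unset Strict Implicit.
Unset Printing Implicit Defensive.

(* A carrier bears two group laws here, so they are kept as data instead of
   canonical instances; [groupOf L] recovers the library structure. *)
Record groupLaw (T : Type) := GroupLaw {
  gop : T -> T -> T;
  gunit : T;
  ginv : T -> T;
  gopA : associative gop;
  gop1g : left_id gunit gop;
  gopVg : left_inverse gunit ginv gop
}.

Definition groupOf (T : Type) (L : groupLaw T) : Type := T.

HB.instance Definition _ (T : finType) (L : groupLaw T) :=
  Finite.on (groupOf L).
HB.instance Definition _ (T : finType) (L : groupLaw T) :=
  Finite_isGroup.Build (groupOf L) (gopA L) (gop1g L) (gopVg L).

Record skewBrace (T : Type) := SkewBrace {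
  addLaw : groupLaw T;
  circLaw : groupLaw T;
  brace_law : forall a b c : T,
    gop circLaw a (gop addLaw b c) =
    gop addLaw (gop addLaw (gop circLaw a b) (ginv addLaw a)) (gop circLaw a c)
}.

Definition badd (T : Type) (B : skewBrace T) : T -> T -> T := gop (addLaw B).
Definition bopp (T : Type) (B : skewBrace T) : T -> T := ginv (addLaw B).
Definition bcirc (T : Type) (B : skewBrace T) : T -> T -> T := gop (circLaw B).

Definition left_brace (T : Type) (B : skewBrace T) : Prop :=
  commutative (badd B).

Definition cyclic_type (T : finType) (B : skewBrace T) : bool :=
  cyclic [set: groupOf (addLaw B)].

Definition bi_skew (T : Type) (B : skewBrace T) : Prop :=
  exists B' : skewBrace T, addLaw B' = circLaw B /\ circLaw B' = addLaw B.

Definition lambda (T : Type) (B : skewBrace T) (a b : T) : T :=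
  badd B (bopp B a) (bcirc B a b).

Definition lambda_ker (T : finType) (B : skewBrace T) : {set T} :=
  [set a | [forall b, lambda B a b == b]].

Definition brace_isom (T T' : Type) (B : skewBrace T) (B' : skewBrace T') :=
  exists f : T -> T',
    [/\ bijective f,
        {morph f : a b / badd B a b >-> badd B' a b}
      & {morph f : a b / bcirc B a b >-> bcirc B' a b}].

Section LambdaAction.
Variables (T : finType) (B : skewBrace T).
Implicit Types a b c : T.

Lemma baddNK a b : badd B a (badd B (bopp B a) b) = b.
Proof. exact: (@mulKVg (groupOf (addLaw B)) a b). Qed.

Lemma baddK a b : badd B (bopp B a) (badd B a b) = b.
Proof. exact: (@mulKg (groupOf (addLaw B)) a b). Qed.

Lemma bcirc_lambda a b : bcirc B a b = badd B a (lambda B a b).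
Proof. by rewrite baddNK. Qed.

Lemma lambda_add a : {morph lambda B a : b c / badd B b c}.
Proof.
move=> b c; rewrite /lambda {1}/bcirc {2}/badd brace_law.
by rewrite -!/(badd B _ _) -!/(bcirc B _ _) -!/(bopp B _) /badd !gopA.
Qed.

Lemma lambda_circ a b c :
  lambda B (bcirc B a b) c = lambda B a (lambda B b c).
Proof.
have H : bcirc B a (bcirc B b c) =
         badd B (bcirc B a b) (lambda B a (lambda B b c)).
  rewrite [bcirc B b c]bcirc_lambda bcirc_lambda lambda_add.
  rewrite [badd B a _](gopA (addLaw B)) -/(badd B a (lambda B a b)).
  by rewrite -bcirc_lambda.
rewrite {1}/lambda -[bcirc B (bcirc B a b) c](gopA (circLaw B)).
by rewrite -!/(bcirc B _ _) H baddK.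
Qed.

Lemma lambda_inj a : injective (lambda B a).
Proof.
move=> b c /(can_inj (baddK (bopp B a))).
exact: (@mulgI (groupOf (circLaw B)) a).
Qed.

End LambdaAction.

(* Main.v *)
(* Uniqueness: let K = ker lambda, of order p^2. Every lambda_x has x^q in K,
   hence lambda_x^q = 1. On an additive generator b0 of the q-part, lambda_x acts
   as multiplication by some k with k^q = 1 mod q, so k = 1 by Fermat. On an
   additive generator a of the p-part, lambda_b0 multiplies by a unit of order q
   (it is nontrivial because b0 is not in K), and, the unit group modulo p^2
   being cyclic, some multiple b of b0 has lambda_b(a) = t a. Then
   (n, m) |-> n a + m b is the isomorphism, since a lies in K and on K the two
   operations agree. *)

Require Import Defs.
From mathcomp Require Import pgroup extremal.

Set Implicit Arguments.
Unset Strict Implicit.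
Unset Printing Implicit Defensive.

Import GRing.Theory.
Local Open Scope ring_scope.

(** * Exponents taken in ['Z_N] *)

Section Exponents.
Variables (N : nat) (N_gt1 : (1 < N)%N).

(** The sum in ['Z_N] is reduced modulo [N], which changes no power of [x] because [x ^+ N = 1]. *)
Lemma expg_ZpD (gT : finGroupType) (x : gT) (i j : 'Z_N) :
  (x ^+ N = 1 -> x ^+ (i + j)%R = x ^+ i * x ^+ j)%g.
Proof. by move=> xN; rewrite /= expg_mod ?Zp_cast // expgD. Qed.

Lemma expg_ZpM (gT : finGroupType) (x : gT) (i j : 'Z_N) :
  (x ^+ N = 1 -> x ^+ (i * j)%R = x ^+ i ^+ j)%g.
Proof. by move=> xN; rewrite /= expg_mod ?Zp_cast // expgM. Qed.

Lemma expg_ZpX (gT : finGroupType) (x : gT) (i : 'Z_N) (k : nat) :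
  (x ^+ N = 1 -> x ^+ (i ^+ k)%R = x ^+ (i ^ k)%N)%g.
Proof.
move=> xN; elim: k => [|k IHk]; first by rewrite !expg1.
by rewrite exprSr expg_ZpM // IHk -expgM expnSr.
Qed.

Lemma expg_Zp_inj (gT : finGroupType) (x : gT) (i j : 'Z_N) :
  #[x]%g = N -> (x ^+ i = x ^+ j)%g -> i = j.
Proof.
move=> ox /eqP; rewrite eq_expg_mod_order ox => /eqP ij; apply: ord_inj.
have ltN (k : 'Z_N) : (k < N)%N by rewrite -[X in (_ < X)%N](Zp_cast N_gt1).
by rewrite -(modn_small (ltN i)) ij modn_small.
Qed.

Lemma expr_ZpD (R : nzRingType) (u : R) (i j : 'Z_N) :
  u ^+ N = 1 -> u ^+ (i + j)%R = u ^+ i * u ^+ j.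
Proof. by move=> uN; rewrite /= expr_mod ?Zp_cast // exprD. Qed.

End Exponents.

(** * The model brace over a commutative ring *)

Section SemidirectBrace.
Variables (R : comNzRingType) (u : R) (q : nat).
Hypotheses (q_gt1 : (1 < q)%N) (uq : u ^+ q = 1).
Local Notation T := (R * 'Z_q)%type.

Definition sd_add (x y : T) : T := (x.1 + y.1, x.2 + y.2).
Definition sd_opp (x : T) : T := (- x.1, - x.2).
Definition sd_circ (x y : T) : T := (x.1 + u ^+ x.2 * y.1, x.2 + y.2).
(** The inverse of [u ^+ m] is written [u ^+ (- m)] with [- m] taken in ['Z_q], which is correct
    because [u ^+ q = 1]. *)
Definition sd_inv (x : T) : T := (- (u ^+ (- x.2)%R * x.1), - x.2).

Let uD := fun i j => expr_ZpD q_gt1 i j uq.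

Lemma sd_exprVK (m : 'Z_q) (x : R) : u ^+ m * (u ^+ (- m)%R * x) = x.
Proof. by rewrite mulrA -uD subrr expr0 mul1r. Qed.

Lemma sd_addA : associative sd_add.
Proof. by move=> x y z; rewrite /sd_add /= !addrA. Qed.

Lemma sd_add0 : left_id (0, 0) sd_add.
Proof. by case=> x m; rewrite /sd_add /= !add0r. Qed.

Lemma sd_addN : left_inverse (0, 0) sd_opp sd_add.
Proof. by move=> x; rewrite /sd_add /= !addNr. Qed.

Lemma sd_circA : associative sd_circ.
Proof.
by move=> x y z; rewrite /sd_circ /= uD mulrDr mulrA !addrA.
Qed.

Lemma sd_circ0 : left_id (0, 0) sd_circ.
Proof. by case=> x m; rewrite /sd_circ /= expr0 mul1r !add0r. Qed.

Lemma sd_circV : left_inverse (0, 0) sd_inv sd_circ.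
Proof. by move=> x; rewrite /sd_circ /= !addNr. Qed.

Definition sd_addLaw := GroupLaw sd_addA sd_add0 sd_addN.
Definition sd_circLaw := GroupLaw sd_circA sd_circ0 sd_circV.

Lemma sd_braceP (a b c : T) :
  sd_circ a (sd_add b c) =
  sd_add (sd_add (sd_circ a b) (sd_opp a)) (sd_circ a c).
Proof.
rewrite /sd_circ /sd_add /=; congr (_, _).
  by rewrite (addrAC a.1) subrr add0r mulrDr addrCA.
by rewrite (addrAC a.2) subrr add0r addrCA.
Qed.

(** The twist depends only on the second coordinate, where both laws coincide. In the first
    coordinate the two terms in [u ^+ b.2 * a.1] cancel. *)
Lemma sd_bibraceP (a b c : T) :
  sd_add a (sd_circ b c) =
  sd_circ (sd_circ (sd_add a b) (sd_inv a)) (sd_add a c).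
Proof.
rewrite /sd_circ /sd_add /sd_inv; cbn [fst snd]; congr (_, _); last first.
  by rewrite [a.2 + b.2]addrC addrK addrCA.
rewrite [a.2 + b.2]addrC addrK uD mulrN -mulrA sd_exprVK mulrDr.
by rewrite [RHS]addrA subrK addrA.
Qed.

Definition sd_brace := @SkewBrace T sd_addLaw sd_circLaw sd_braceP.

Lemma sd_bi_skew : bi_skew sd_brace.
Proof. by exists (@SkewBrace T sd_circLaw sd_addLaw sd_bibraceP). Qed.

Lemma sd_left_brace : left_brace sd_brace.
Proof. by move=> x y; congr (_, _); apply: addrC. Qed.

Lemma sd_lambdaE (x y : T) : lambda sd_brace x y = (u ^+ x.2 * y.1, y.2).
Proof. by congr (_, _); apply: addKr. Qed.

End SemidirectBrace.

(** * Cyclic groups and the units modulo [p ^ 2] *)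

Lemma cycle_sub_cyclic (gT : finGroupType) (G : {group gT}) (x y : gT) :
  cyclic G -> x \in G -> y \in G -> (y \in <[x]>)%g = (y ^+ #[x] == 1)%g.
Proof.
move=> cycG Gx Gy; rewrite -cycle_subG -order_dvdn.
(* In a cyclic group, containment of subgroups is divisibility of their orders. *)
by rewrite (cardSg_cyclic cycG) ?cycle_subG.
Qed.

Lemma expg_fixP (gT : finGroupType) (x : gT) (k : nat) :
  (x ^+ k)%g = x <-> k = 1 %[mod #[x]%g].
Proof.
split=> [/eqP|/eqP]; last by rewrite -eq_expg_mod_order => /eqP.
by rewrite -{2}(expg1 x) eq_expg_mod_order => /eqP.
Qed.

(** The units are the automorphisms of a cyclic group of order [p ^ 2]. That group is cyclic for odd
    [p], and for [p = 2] the exponent 2 is small enough that a single involution generates it. *)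
Lemma units_Zp_square_cyclic (p : nat) :
  prime p -> cyclic (units_Zp (p ^ 2)).
Proof.
move=> p_pr; have p2_gt1: (1 < p ^ 2)%N by rewrite (ltn_exp2l 0) ?prime_gt1.
pose x : 'Z_(p ^ 2) := 1; pose G := <[x]>%g.
have ox: #[x]%g = (p ^ 2)%N by rewrite order_Zp1 Zp_cast.
have pG : (p.-group G)%g by rewrite /pgroup -orderE ox pnatX pnat_id.
have ntG : G != 1%g by rewrite -cardG_gt1 -orderE ox.
rewrite -ox (isog_cyclic (Zp_unit_isog x)).
have [m [_ _]] := cyclic_pgroup_Aut_structure pG (cycle_cyclic x) ntG.
have ->: (logn p #|G|).-1 = 1%N by rewrite -orderE ox pfactorK.
by case=> s [_ _ _] /=; case: ifP => [_ [[]] | _ ->] //; rewrite cycle_cyclic.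
Qed.

(** * The model over ['Z_N * 'Z_q]: type, kernel, presentation *)

Section SemidirectZp.
Variables (N q : nat) (t : {unit 'Z_N}).
Hypotheses (N_gt1 : (1 < N)%N) (q_gt1 : (1 < q)%N).
Hypothesis tq : val t ^+ q = 1.
Local Notation M := (sd_brace q_gt1 tq).
Local Notation T := ('Z_N * 'Z_q)%type.

Lemma sd_card : #|{: T}| = (N * q)%N.
Proof. by rewrite card_prod !card_ord !Zp_cast. Qed.

Lemma sd_addE (x y : groupOf (addLaw M)) : (x * y)%g = sd_add x y :> T.
Proof. by []. Qed.

Lemma sd_circE (x y : groupOf (circLaw M)) :
  (x * y)%g = sd_circ (val t) x y :> T.
Proof. by []. Qed.

Lemma sd_addX k :
  (((1, 1)%R : groupOf (addLaw M)) ^+ k)%g = (k%:R, k%:R) :> T.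
Proof.
by elim: k => // k IHk; rewrite expgS IHk [LHS]sd_addE /sd_add /= !mulrS.
Qed.

(** The order of [(1, 1)] is divisible by [N] and by [q], hence by the size of the carrier. *)
Lemma sd_cyclic_type : coprime N q -> cyclic_type M.
Proof.
move=> coNq; apply/cyclicP; exists ((1, 1)%R : groupOf (addLaw M)).
apply/esym/eqP; rewrite eqEcard subsetT cardsT sd_card /= -orderE.
rewrite dvdn_leq // Gauss_dvd //.
have /eqP := expg_order ((1, 1)%R : groupOf (addLaw M)).
move: #[_]%g => k; rewrite sd_addX -[1%g]/(0, 0) => /eqP[/eqP + /eqP].
by rewrite -!val_eqE /= !val_Zp_nat //; rewrite /dvdn => -> ->.
Qed.

(** Evaluating [lambda] of [(n, m)] at [(1, 0)] isolates [t ^+ m], which is 1 only for [m = 0]; the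
    kernel is the first factor. *)
Lemma sd_card_lambda_ker : #[t]%g = q -> #|lambda_ker M| = N.
Proof.
move=> ot.
have tX m : (val t ^+ m == 1) = (t ^+ m == 1)%g.
  by rewrite -(inj_eq val_inj (t ^+ m)%g) /= FinRing.val_unitX.
suff ->: lambda_ker M = setX setT [set 0].
  by rewrite cardsX cards1 muln1 cardsT card_ord Zp_cast.
apply/setP=> [[n m]]; rewrite !inE /=; apply/forallP/eqP=> [|-> [s r]].
  move/(_ (1, 0)); rewrite sd_lambdaE /= mulr1 => /eqP[/eqP].
  rewrite tX -order_dvdn ot => /dvdn_leq; case: (posnP m) => [m0 _|_ /(_ isT)].
    exact: val_inj.
  by rewrite leqNgt -{2}(Zp_cast q_gt1) ltn_ord.
by rewrite sd_lambdaE expr0 mul1r.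
Qed.

Lemma sd_circX1 k :
  (((1, 0)%R : groupOf (circLaw M)) ^+ k)%g = (k%:R, 0)%R :> T.
Proof.
elim: k => // k IHk; rewrite expgS IHk [LHS]sd_circE.
by rewrite /sd_circ /= expr0 mul1r addr0 mulrS.
Qed.

Lemma sd_circX2 k :
  (((0, 1)%R : groupOf (circLaw M)) ^+ k)%g = (0, k%:R) :> T.
Proof.
elim: k => // k IHk; rewrite expgS IHk [LHS]sd_circE.
by rewrite /sd_circ /= mulr0 addr0 mulrS.
Qed.

Lemma sd_circ_gen (n : 'Z_N) (m : 'Z_q) :
  (((1, 0)%R : groupOf (circLaw M)) ^+ n *
   ((0, 1)%R : groupOf (circLaw M)) ^+ m)%g = (n, m) :> T.
Proof.
rewrite sd_circX1 sd_circX2 [LHS]sd_circE /sd_circ /=.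
by rewrite mulr0 addr0 add0r !natr_Zp.
Qed.

(** This is the twist of [sd_circ], derived in an arbitrary group from the defining relations. *)
Lemma conj_powers (gT : finGroupType) (x y : gT) (m : nat) (s : 'Z_N) :
  (x ^+ N = 1 -> y * x * y^-1 = x ^+ val t ->
   y ^+ m * x ^+ s = x ^+ (val t ^+ m * s)%R * y ^+ m)%g.
Proof.
move=> xN yx; elim: m s => [|m IHm] s; first by rewrite !mul1g mul1r mulg1.
rewrite expgSr exprSr -mulgA -mulrA.
suff ->: (y * x ^+ s = x ^+ (val t * s)%R * y)%g by rewrite mulgA IHm mulgA.
rewrite expg_ZpM // -yx; apply: (canRL (mulgKV _)).
have yE z : (y * z * y^-1 = z ^ y^-1)%g by rewrite conjgE invgK mulgA.
by rewrite !yE conjXg.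
Qed.

Lemma sd_circ_isoGrp :
  ([set: groupOf (circLaw M)] \isog
     Grp (x : y : x ^+ N, y ^+ q, y * x * y^-1 = x ^+ val t))%g.
Proof.
(* Two things are needed: generators of the model satisfying the relations, and a surjection from
   the model onto any group generated by such a pair. *)
apply: intro_isoGrp => [|rT H].
  pose x : groupOf (circLaw M) := (1, 0).
  pose y : groupOf (circLaw M) := (0, 1).
  apply/existsP; exists (x, y); rewrite /= !xpair_eqE; apply/and4P; split.
  - rewrite eqEsubset subsetT; apply/subsetP=> [[n m] _].
    rewrite -sd_circ_gen groupM // groupX // mem_gen // inE cycle_id ?orbT //.
  - by rewrite sd_circX1 pchar_Zp.
  - by rewrite sd_circX2 pchar_Zp.
  have yx: (y * x = x ^+ val t * y)%g.
    rewrite sd_circX1 natr_Zp !sd_circE /sd_circ /=.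
    by rewrite mulr1 mulr0 !addr0 !add0r modn_small.
  by rewrite yx mulgK.
case/existsP=> [[x y]] /= /eqP[defH xN yq yx].
pose f (z : groupOf (circLaw M)) := (x ^+ z.1 * y ^+ z.2)%g.
have fM : {in setT &, {morph f : z w / (z * w)%g}}.
  move=> [n m] [s r] _ _; rewrite /f sd_circE /sd_circ.
  rewrite [(_, _).1]/= [(_, _).2]/= !expg_ZpD // -!mulgA; congr (_ * _)%g.
  by rewrite !mulgA conj_powers.
apply/homgP; exists (Morphism fM); apply/eqP; rewrite eqEsubset.
have [Hx Hy]: x \in H /\ y \in H.
  by rewrite -defH -!cycle_subG joing_subl joing_subr.
apply/andP; split.
  by apply/subsetP=> _ /morphimP[z _ _ ->] /=; rewrite groupM ?groupX.
rewrite -defH join_subG !cycle_subG; apply/andP; split.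
  by apply/morphimP; exists (1, 0); rewrite ?inE //= /f /= mulg1.
by apply/morphimP; exists (0, 1); rewrite ?inE //= /f /= mul1g.
Qed.

End SemidirectZp.

(** * The kernel of [lambda] as a subgroup for both laws *)

Lemma card_groupOf (T : finType) (L : groupLaw T) : #|{: groupOf L}| = #|T|.
Proof.
by apply: (@bij_eq_card _ _ (fun x : groupOf L => x : T)); exists id.
Qed.

Section LambdaKernel.
Variables (T : finType) (B : skewBrace T).
Local Notation A := (groupOf (addLaw B)).
Local Notation C := (groupOf (circLaw B)).

Lemma lambda1 (b : T) : lambda B (1%g : C) b = b.
Proof.
apply: (@lambda_inj _ B (1%g : C)); rewrite -lambda_circ; congr (lambda B _ b).
exact: (mulg1 (1%g : C)).
Qed.

(** The circle identity acts trivially, so it is idempotent for addition. *)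
Lemma circ_unitE : (1%g : C) = (1%g : A) :> T.
Proof.
apply: (@mulgI A (1%g : C)); rewrite mulg1.
transitivity (bcirc B (1%g : C) (1%g : C)); last exact: (mulg1 (1%g : C)).
by rewrite bcirc_lambda lambda1.
Qed.

Lemma lambda_addX (a : T) (x : A) k :
  lambda B a (x ^+ k)%g = ((lambda B a x : A) ^+ k)%g.
Proof.
have lM (y z : A) :
    lambda B a (y * z)%g = ((lambda B a y : A) * (lambda B a z : A))%g.
  exact: lambda_add.
elim: k => [|k IHk]; last by rewrite !expgS lM IHk.
by apply: (mulgI (lambda B a (1%g : A) : A)); rewrite -lM !mulg1.
Qed.

Lemma lambda_circX (x : C) k (b : T) :
  lambda B (x ^+ k)%g b = iter k (lambda B x) b.
Proof.
elim: k => [|k IHk]; first exact: lambda1.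
by rewrite expgS [LHS]lambda_circ IHk.
Qed.

(** When [lambda B x] fixes [x], the additive multiples of [x] are also its circle powers. *)
Lemma lambda_fixX (x : A) k c :
  lambda B x x = x -> lambda B (x ^+ k)%g c = iter k (lambda B x) c.
Proof.
move=> lx.
suff ->: (x ^+ k)%g = ((x : C) ^+ k)%g :> T by exact: lambda_circX.
elim: k => [|k IHk]; first by rewrite !expg0 circ_unitE.
rewrite !expgS -[in RHS]IHk.
transitivity (bcirc B x (x ^+ k)%g); last by [].
by rewrite bcirc_lambda lambda_addX lx.
Qed.

Lemma lambda_kerP (a : T) :
  reflect (forall b, lambda B a b = b) (a \in lambda_ker B).
Proof. by rewrite inE; apply: (iffP forallP) => H b; apply/eqP; apply: H. Qed.

Lemma lambda_ker_circ (a b : T) :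
  a \in lambda_ker B -> bcirc B a b = badd B a b.
Proof. by move/lambda_kerP => la; rewrite bcirc_lambda la. Qed.

(* [groupOf L] is a finType of its own, not convertible to [T], so the kernel has
   to be recast as a set of group elements before it can be a subgroup. *)
Definition kerA : {set A} := [set a : A | (a : T) \in lambda_ker B].
Definition kerC : {set C} := [set a : C | (a : T) \in lambda_ker B].

Lemma in_kerA (a : A) : (a \in kerA) = ((a : T) \in lambda_ker B).
Proof. by rewrite inE. Qed.

Lemma in_kerC (a : C) : (a \in kerC) = ((a : T) \in lambda_ker B).
Proof. by rewrite inE. Qed.

Lemma card_kerA : #|kerA| = #|lambda_ker B|.
Proof.
rewrite -(card_imset (mem kerA) (f := fun a : A => a : T)) //.
apply: eq_card => a.
apply/imsetP/idP=> [[b + ->]|Ka]; first by rewrite in_kerA.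
by exists a => //; rewrite in_kerA.
Qed.

Lemma card_kerC : #|kerC| = #|lambda_ker B|.
Proof.
rewrite -(card_imset (mem kerC) (f := fun a : C => a : T)) //.
apply: eq_card => a.
apply/imsetP/idP=> [[b + ->]|Ka]; first by rewrite in_kerC.
by exists a => //; rewrite in_kerC.
Qed.

Lemma kerC_group_set : group_set kerC.
Proof.
apply/group_setP; split=> [|a b]; rewrite !in_kerC.
  by apply/lambda_kerP => b; apply: lambda1.
move=> /lambda_kerP la /lambda_kerP lb.
by apply/lambda_kerP => c; rewrite [LHS]lambda_circ lb la.
Qed.

Lemma kerA_group_set : group_set kerA.
Proof.
apply/group_setP; split=> [|a b]; rewrite !in_kerA.
  by rewrite -circ_unitE; apply/lambda_kerP => b; apply: lambda1.
move=> Ka; rewrite -[(a * b)%g](lambda_ker_circ _ Ka).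
move/lambda_kerP: Ka => la /lambda_kerP lb.
by apply/lambda_kerP => c; rewrite lambda_circ lb la.
Qed.

Canonical kerC_group := Group kerC_group_set.
Canonical kerA_group := Group kerA_group_set.

Lemma kerC_normal : (kerC <| [set: C])%g.
Proof.
rewrite /normal subsetT; apply/subsetP=> x _; rewrite inE.
apply/subsetP=> _ /imsetP[z Kz ->]; move: Kz.
rewrite !in_kerC => /lambda_kerP lz.
apply/lambda_kerP=> c; rewrite conjgE [LHS]lambda_circ.
rewrite [X in lambda B _ X]lambda_circ.
rewrite lz -lambda_circ -[RHS](lambda1 c); congr (lambda B _ c).
exact: (mulVg (x : C)).
Qed.

(** The quotient by the kernel has order equal to the index, so the circle power of [x] with that
    exponent lies in the kernel. *)
Lemma lambda_iter_index (x c : T) :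
  iter #|[set: C] : kerC|%g (lambda B x) c = c.
Proof.
rewrite -(lambda_circX x); move: c; apply/lambda_kerP.
have Nx: (x : C) \in 'N(kerC)%g.
  by rewrite (subsetP (normal_norm kerC_normal)) ?inE.
suff: ((x : C) ^+ #|[set: C] : kerC| \in kerC)%g by rewrite in_kerC.
apply: coset_idr; rewrite ?groupX // morphX //.
apply/eqP; rewrite -order_dvdn -card_quotient ?normal_norm ?kerC_normal //.
by rewrite order_dvdG // mem_quotient ?inE.
Qed.

End LambdaKernel.

(** * Uniqueness *)

Section Uniqueness.
Variables (p q : nat) (t : {unit 'Z_(p ^ 2)}).
Hypotheses (p_pr : prime p) (q_pr : prime q) (pDq : p <> q) (ot : #[t]%g = q).
Variables (T : finType) (B : skewBrace T).
Hypotheses (cardT : #|T| = (p ^ 2 * q)%N) (cycB : cyclic_type B).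
Hypothesis cardK : #|lambda_ker B| = (p ^ 2)%N.
Local Notation A := (groupOf (addLaw B)).

Let p2_gt1 : (1 < p ^ 2)%N.
Proof. by rewrite (ltn_exp2l 0) ?prime_gt1. Qed.

Let q_gt1 : (1 < q)%N := prime_gt1 q_pr.

Let co_p2q : coprime (p ^ 2) q.
Proof. by rewrite coprimeXl // prime_coprime // dvdn_prime2 //; apply/eqP. Qed.

Lemma lambda_iter (x c : T) : iter q (lambda B x) c = c.
Proof.
have <- : #|[set: groupOf (circLaw B)] : kerC B|%g = q.
  rewrite -divgS ?subsetT // cardsT card_kerC cardK.
  by rewrite card_groupOf cardT mulKn // ltnW.
exact: lambda_iter_index.
Qed.

Lemma iter_lambda_scale (x : T) (a : A) k j :
  lambda B x a = (a ^+ k)%g -> iter j (lambda B x) a = (a ^+ (k ^ j))%g.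
Proof.
move=> xa; elim: j => [|j IHj]; first by rewrite expg1.
by rewrite iterS IHj lambda_addX xa -expgM expnS mulnC.
Qed.

(** An additive endomorphism sends [a] to an element killed by the order of [a], and in a cyclic
    group such elements lie in the subgroup generated by [a]. *)
Lemma lambda_stable (x : T) (a : A) :
  exists k, lambda B x a = (a ^+ k)%g.
Proof.
suff /cycleP: (lambda B x a : A) \in <[a]>%g by [].
rewrite (cycle_sub_cyclic cycB) ?inE //.
(* Writing the additive identity as a zeroth power shows that [lambda] fixes it. *)
by rewrite -lambda_addX expg_order -(expg0 (1%g : A)) lambda_addX expg0.
Qed.

Lemma lambda_fix_order_q (x : T) (b : A) : #[b]%g = q -> lambda B x b = b.
Proof.
move=> ob; have [k xb] := lambda_stable x b.
have := lambda_iter x b; rewrite (iter_lambda_scale q xb) xb.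
move/(expg_fixP b); rewrite ob fermat_little // => k1.
by apply/(expg_fixP b); rewrite ob.
Qed.

(** The kernel is an additive subgroup of order [p ^ 2], and a cyclic group has only one of that
    order. *)
Lemma kerA_order (a : A) : #[a]%g = (p ^ 2)%N -> (a : T) \in lambda_ker B.
Proof.
move=> oa; rewrite -in_kerA -cycle_subG.
rewrite -(cardSg_cyclic cycB) ?subsetT //=.
by rewrite -orderE oa card_kerA cardK.
Qed.

Lemma lambda_frame :
  exists a b : A, [/\ #[a]%g = (p ^ 2)%N, #[b]%g = q
                    & lambda B b a = (a ^+ val t)%g].
Proof.
have [g defA] := cyclicP cycB.
have og : #[g]%g = (p ^ 2 * q)%N by rewrite orderE -defA cardsT card_groupOf.
pose a := (g ^+ q)%g; pose b := (g ^+ (p ^ 2))%g.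
have oa : #[a]%g = (p ^ 2)%N.
  by rewrite orderXdiv og ?dvdn_mull // mulnK // ltnW.
have ob : #[b]%g = q.
  by rewrite orderXdiv og ?(dvdn_mulr _ (dvdnn _)) // mulKn // ltnW.
have [k ba] := lambda_stable b a.
have kq1 : (k%:R : 'Z_(p ^ 2)) ^+ q = 1.
  have := lambda_iter b a; rewrite (iter_lambda_scale q ba).
  move/(expg_fixP a); rewrite oa => kq1.
  by apply: ord_inj; rewrite -natrX val_Zp_nat // kq1 modn_small.
have Uk : (k%:R : 'Z_(p ^ 2)) \is a GRing.unit.
  by rewrite -(unitrX_pos _ (ltnW q_gt1)) kq1 unitr1.
pose U : {unit 'Z_(p ^ 2)} := FinRing.unit _ Uk.
(* If [U] were trivial, [lambda B b] would fix the additive generator [a * b]. Then [b], of order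
   [q], would lie in the kernel, whose order [p ^ 2] is prime to [q]. *)
have ntU : U != 1%g.
  apply/eqP => /(congr1 val) /= /(congr1 (@nat_of_ord _)).
  rewrite val_Zp_nat // => k1.
  have baa: lambda B b a = a.
    by rewrite ba; apply/(expg_fixP a); rewrite oa k1 modn_small.
  suff: (b : T) \in lambda_ker B.
    rewrite -in_kerA => /order_dvdG; rewrite /= card_kerA cardK ob => q_p2.
    by move: co_p2q; rewrite coprime_sym prime_coprime // q_p2.
  apply/lambda_kerP => c.
  have: (c : A) \in <[a * b]>%g.
    rewrite (cycle_sub_cyclic cycB) ?inE // orderM ?oa ?ob //; last first.
      by rewrite /a /b /commute -!expgD addnC.
    by rewrite -cardT -(card_groupOf (addLaw B)) -cardsT expg_cardG ?inE.
  case/cycleP => j ->; rewrite lambda_addX.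
  suff ->: lambda B b (a * b)%g = (a * b)%g by [].
  by rewrite [LHS]lambda_add baa lambda_fix_order_q.
have oU : #[U]%g = q.
  apply: nt_prime_order => //; apply: val_inj.
  by rewrite FinRing.val_unitX.
(* Both [t] and [U] have order [q] in a cyclic group, so [t] is some [U ^+ j]; the exponent [j] then
   corrects [b]. *)
have : t \in <[U]>%g.
  rewrite (cycle_sub_cyclic (units_Zp_square_cyclic p_pr)) ?inE //.
  by rewrite oU -ot expg_order.
case/cycleP => j tU; exists a, (b ^+ j)%g.
have bja : lambda B (b ^+ j)%g a = (a ^+ val t)%g.
  rewrite lambda_fixX ?lambda_fix_order_q // (iter_lambda_scale j ba).
  suff /eqP: (a ^+ (k ^ j) == a ^+ val t)%g by [].
  rewrite eq_expg_mod_order oa tU FinRing.val_unitX /= -natrX.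
  by rewrite val_Zp_nat // modn_mod.
split=> //; apply: nt_prime_order => //.
  by rewrite -expgM mulnC expgM -ob expg_order expg1n.
(* A trivial [b ^+ j] would give [a ^+ val t = a], forcing [t = 1]. *)
apply/eqP => bj1; have : t != 1%g by rewrite -order_gt1 ot.
case/negP; apply/eqP/val_inj/val_inj => /=.
move: bja; rewrite bj1 -circ_unitE lambda1 => /esym/(expg_fixP a); rewrite oa.
rewrite [RHS]modn_small // modn_small //.
by rewrite -[X in (_ < X)%N](Zp_cast p2_gt1).
Qed.

Lemma brace_isom_sd (tq : val t ^+ q = 1) : left_brace B ->
  brace_isom (sd_brace q_gt1 tq) B.
Proof.
move=> addC; have [a [b [oa ob ba]]] := lambda_frame.
have mulC (x y : A) : commute x y by exact: addC.
have ap : (a ^+ (p ^ 2) = 1)%g by rewrite -oa expg_order.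
have bq : (b ^+ q = 1)%g by rewrite -ob expg_order.
have Ka : (a : T) \in lambda_ker B by apply: kerA_order.
pose f (x : 'Z_(p ^ 2) * 'Z_q) : A := (a ^+ x.1 * b ^+ x.2)%g.
have fM (i k : 'Z_(p ^ 2)) (j l : 'Z_q) :
    (a ^+ (i + k)%R * b ^+ (j + l)%R = a ^+ i * b ^+ j * (a ^+ k * b ^+ l))%g.
  rewrite !expg_ZpD // -!mulgA; congr (_ * _)%g.
  by rewrite !mulgA; congr (_ * _)%g; apply: mulC.
(* The [a]-part of [f x] lies in the kernel, so it can be split off as a circle factor that acts
   trivially. *)
have lf x c : lambda B (f x) c = iter x.2 (lambda B b) c.
  have Kax : ((a ^+ x.1)%g : T) \in lambda_ker B.
    by rewrite -in_kerA groupX // in_kerA.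
  rewrite -[f x](lambda_ker_circ _ Kax) lambda_circ.
  by move/lambda_kerP: Kax => ->; rewrite lambda_fixX ?lambda_fix_order_q.
exists f; split.
- apply: inj_card_bij; last by rewrite sd_card // cardT.
  move=> [n m] [s r]; rewrite /f /= => fE.
  (* Coprime orders make the decomposition into a power of [a] and a power of [b] unique. *)
  have tiab : (<[a]> :&: <[b]> = 1)%g by rewrite coprime_TIg // -!orderE oa ob.
  have E : ((a ^+ s)^-1 * a ^+ n = b ^+ r * (b ^+ m)^-1)%g.
    by apply: (canRL (mulgK _)); rewrite -mulgA fE mulKg.
  have : ((a ^+ s)^-1 * a ^+ n \in <[a]> :&: <[b]>)%g.
    by rewrite inE {2}E !(groupM, groupV, mem_cycle).
  rewrite tiab => /set1P E1; move: E; rewrite E1 => /esym/eqP.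
  rewrite -eq_mulgV1 => /eqP/(expg_Zp_inj q_gt1 ob) ->.
  by move/eqP: E1; rewrite -eq_mulVg1 => /eqP/(expg_Zp_inj p2_gt1 oa) ->.
- move=> [n m] [s r]; exact: fM.
move=> [n m] [s r]; rewrite bcirc_lambda lf.
have -> : iter (n, m).2 (lambda B b) (f (s, r)) =
        (a ^+ (val t ^+ m * s)%R * b ^+ r)%g.
  rewrite -(lambda_fixX m (f (s, r)) (lambda_fix_order_q b ob)).
  rewrite /f [LHS]lambda_add !lambda_addX (lambda_fix_order_q _ ob).
  rewrite lambda_fixX ?lambda_fix_order_q //.
  rewrite (iter_lambda_scale m ba) expg_ZpM //.
  by rewrite expg_ZpX.
exact: fM.
Qed.

End Uniqueness.

(** * Existence and uniqueness combined *)

Lemma brace_isom_sym (T T' : Type) (B : skewBrace T) (B' : skewBrace T') :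
  brace_isom B B' -> brace_isom B' B.
Proof.
case=> f [[g fK gK] fA fC]; exists g; split; first by exists f.
  by move=> x y; rewrite -{1}(gK x) -{1}(gK y) -fA fK.
by move=> x y; rewrite -{1}(gK x) -{1}(gK y) -fC fK.
Qed.

Theorem theorem3p3 (p q : nat) (t : {unit 'Z_(p ^ 2)}) :
  prime p -> prime q -> p <> q -> q <> 1 %[mod p] -> #[t]%g = q ->
  exists M : skewBrace ('Z_(p ^ 2) * 'Z_q)%type,
    [/\ (forall (n s : 'Z_(p ^ 2)) (m r : 'Z_q),
           badd M (n, m) (s, r) = (n + s, m + r)),
        (forall (n s : 'Z_(p ^ 2)) (m r : 'Z_q),
           bcirc M (n, m) (s, r) = (n + val t ^+ m * s, m + r)),
        [/\ left_brace M, #|{: 'Z_(p ^ 2) * 'Z_q}| = (p ^ 2 * q)%N,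
            cyclic_type M & #|lambda_ker M| = (p ^ 2)%N],
        (forall (T : finType) (B : skewBrace T),
           left_brace B -> #|T| = (p ^ 2 * q)%N -> cyclic_type B ->
           #|lambda_ker B| = (p ^ 2)%N -> brace_isom B M)
      & ([set: groupOf (circLaw M)] \isog
           Grp (x : y : x ^+ (p ^ 2), y ^+ q, y * x * y^-1 = x ^+ val t))%g
        /\ bi_skew M].
Proof.
move=> p_pr q_pr pDq _ ot.
have p2_gt1 : (1 < p ^ 2)%N by rewrite (ltn_exp2l 0) ?prime_gt1.
have q_gt1 := prime_gt1 q_pr.
have co_p2q : coprime (p ^ 2) q.
  by rewrite coprimeXl // prime_coprime // dvdn_prime2 //; apply/eqP.
have tq : val t ^+ q = 1 by rewrite -FinRing.val_unitX -ot expg_order.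
exists (sd_brace q_gt1 tq); split=> //.
- split; [exact: sd_left_brace | exact: sd_card | exact: sd_cyclic_type |].
  exact: sd_card_lambda_ker.
- move=> T B addC cardT cycB cardK; apply: brace_isom_sym.
  (* The model carries a proof of [1 < q]; any two such proofs are equal. *)
  by rewrite (bool_irrelevance q_gt1 (prime_gt1 q_pr)); apply: brace_isom_sd.
by split; [exact: sd_circ_isoGrp | exact: sd_bi_skew].
Qed.
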